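(* Let $w$ be a word in $x,y,x^{-1},y^{-1}$ such that a finite group $H$ is solvable if and only if for some $m\ge 1$ the identity ${}^{w}u_m(x,y)\equiv 1$ holds in $H$. Let $K$ be a field, let $n\ge 1$, and let $G$ be a subgroup of $\mathrm{GL}(n,K)$. Then $G$ is solvable if and only if $G$ is quasi-Engel (with respect to $w$).
   Context: For a word $w$ in $x,y,x^{-1},y^{-1}$, the words ${}^{w}u_m(x,y)$ are defined by ${}^{w}u_1=w$ and ${}^{w}u_{m+1}=[x\,{}^{w}u_m\,x^{-1},\;y\,{}^{w}u_m\,y^{-1}]$, where $[g,h]=ghg^{-1}h^{-1}$. The identity $u(x,y)\equiv1$ holds in a group $G$ if $u(g,h)=1$ for all $g,h\in G$. A group $G$ (not necessarily finite) is called quasi-Engel (with respect to $w$) if there is an integer $m\ge 1$ such that the identity ${}^{w}u_m(x,y)\equiv 1$ holds in $G$. *)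

(* Defs.v *)
From HB Require Import structures.
From mathcomp Require Import all_boot all_order all_algebra.
From mathcomp Require Import all_fingroup all_solvable.
From mathcomp Require Import boolp classical_sets.

Set Implicit Arguments.
Unset Strict Implicit.
Unset Printing Implicit Defensive.

Local Open Scope classical_set_scope.
Local Open Scope group_scope.

(* Words need not be reduced: reduction does not change the value of a word   *)
(* in a group.                                                                *)
Inductive letter := LX | LY | LXinv | LYinv.

Definition word := seq letter.

Definition letter_inv (l : letter) : letter :=
  match l with LX => LXinv | LY => LYinv | LXinv => LX | LYinv => LY end.

Definition word_inv (u : word) : word := rev (map letter_inv u).

(* [g, h] = g h g^-1 h^-1, whereas commg is g^-1 h^-1 g h                     *)
Definition word_comm (u v : word) : word :=
  u ++ v ++ word_inv u ++ word_inv v.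

Definition quasi_engel_step (u : word) : word :=
  word_comm ([:: LX] ++ u ++ [:: LXinv]) ([:: LY] ++ u ++ [:: LYinv]).

(* Meaningful for 1 <= m, with quasi_engel_word w 1 = w; the value w at m = 0 *)
(* is junk.                                                                   *)
Definition quasi_engel_word (w : word) (m : nat) : word :=
  iter m.-1 quasi_engel_step w.

Definition letter_eval (gT : groupType) (g h : gT) (l : letter) : gT :=
  match l with LX => g | LY => h | LXinv => g^-1 | LYinv => h^-1 end.

Definition word_eval (gT : groupType) (g h : gT) (u : word) : gT :=
  \prod_(l <- u) letter_eval g h l.

Definition identity_holds (gT : groupType) (u : word) (G : set gT) : Prop :=
  forall g h : gT, G g -> G h -> word_eval g h u = 1.

Definition quasi_engel (gT : groupType) (w : word) (G : set gT) : Prop :=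
  exists m : nat, (1 <= m)%N /\ identity_holds (quasi_engel_word w m) G.

Definition is_subgroup (gT : groupType) (G : set gT) : Prop :=
  [/\ G 1,
      forall x y : gT, G x -> G y -> G (x * y)
    & forall x : gT, G x -> G x^-1].

Definition derived_subgroup (gT : groupType) (G : set gT) : set gT :=
  smallest (@is_subgroup gT)
    [set z | exists x y : gT, [/\ G x, G y & z = x * y * x^-1 * y^-1]].

Definition solvable_subgroup (gT : groupType) (G : set gT) : Prop :=
  exists d : nat, iter d (@derived_subgroup gT) G = [set 1].

(* The library's {'GL_n[R]} requires a finite ring of coefficients.           *)
Record GL (n : nat) (K : fieldType) :=
  GLmx { GL_val :> 'M[K]_n; GL_valP : GL_val \in unitmx }.

HB.instance Definition _ (n : nat) (K : fieldType) :=
  [isSub for @GL_val n K].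
HB.instance Definition _ (n : nat) (K : fieldType) :=
  [Choice of GL n K by <:].

Section GLGroup.
Variables (n : nat) (K : fieldType).
Implicit Types A B C : GL n K.

Fact GL_mul_subproof A B : (A *m B)%R \in unitmx.
Proof. by rewrite unitmx_mul !GL_valP. Qed.
Definition GL_mul A B : GL n K := GLmx (GL_mul_subproof A B).
Definition GL_one : GL n K := GLmx (unitmx1 K n).
Fact GL_inv_subproof A : invmx A \in unitmx.
Proof. by rewrite unitmx_inv GL_valP. Qed.
Definition GL_inv A : GL n K := GLmx (GL_inv_subproof A).

Fact GL_mulA : associative GL_mul.
Proof. by move=> A B C; apply: val_inj; rewrite /= mulmxA. Qed.
Fact GL_mul1 : left_id GL_one GL_mul.
Proof. by move=> A; apply: val_inj; rewrite /= mul1mx. Qed.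
Fact GL_mulr1 : right_id GL_one GL_mul.
Proof. by move=> A; apply: val_inj; rewrite /= mulmx1. Qed.
Fact GL_mulV : left_inverse GL_one GL_inv GL_mul.
Proof. by move=> A; apply: val_inj; rewrite /= mulVmx ?GL_valP. Qed.
Fact GL_mulrV : right_inverse GL_one GL_inv GL_mul.
Proof. by move=> A; apply: val_inj; rewrite /= mulmxV ?GL_valP. Qed.

HB.instance Definition _ :=
  isGroup.Build (GL n K) GL_mulA GL_mul1 GL_mulr1 GL_mulV GL_mulrV.

End GLGroup.

(* Main.v *)
Require Import Defs.
From HB Require Import structures.
From mathcomp Require Import boolp classical_sets.
From mathcomp Require Import all_boot all_order all_algebra.
From mathcomp Require Import all_fingroup all_solvable all_field.
From mathcomp Require Import mxrepresentation.

(* If G is solvable, the value of u_(m+1) lies in the m-th derived subgroup.  *)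
(* Conversely, by Zassenhaus, finite solvable linear groups of degree n have  *)
(* derived length at most d = d(n); we claim the same bound for G. If it      *)
(* fails, some z <> 1 lies in the d-th derived subgroup of a subgroup of G    *)
(* generated by a finite set s. The entries of the elements of s and of their *)
(* inverses generate a ring with a homomorphism to a finite field that keeps  *)
(* a given nonzero entry of z - 1 nonzero. The image of <s> in the finite     *)
(* general linear group satisfies the identity, hence is solvable, so its     *)
(* d-th derived subgroup is trivial although it contains the image of z,      *)
(* which is not 1.                                                            *)
(* For Zassenhaus' theorem, work over a closed field by induction on n: a     *)
(* nonscalar solvable G has a normal subgroup B that is nonscalar and abelian *)
(* modulo scalars. Eigenvectors with distinct characters are independent;     *)
(* this bounds by n ^ 2 the index of a subgroup C such that C' has a proper   *)
(* nonzero invariant subspace.                                                *)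

Set Implicit Arguments.
Unset Strict Implicit.
Unset Printing Implicit Defensive.
Import GroupScope GRing.Theory.

(** * Derived series of finite solvable groups *)

(** The argument combines a uniform bound with residual finiteness. [zassenhaus_GL] bounds the
    derived length of a solvable subgroup of a finite general linear group by a number that depends
    on the degree alone; this uniformity lets finite images control an infinite group. Its core is
    [reducible_solvable]: a nonscalar solvable group has a derived subgroup of bounded depth that
    stabilises a proper nonzero subspace, and [der_rker_mxmodule] joins the bounds for that subspace
    and for its quotient.

    [residually_finite_field_fg] says that homomorphisms to finite fields separate the nonzero
    elements of a finitely generated subring of a field from 0. [fg_linear_specialisation] turns
    this into Malcev's residual finiteness of finitely generated linear groups, with images of the
    same degree; [iter_derived_subgroup_fg] provides the finite generation. The finite images
    inherit the identity, so the hypothesis on [w] makes them solvable. The other direction is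
    [solvable_quasi_engel]. *)

Lemma der_sub_leq (gT : finGroupType) (G : {group gT}) (i j : nat) :
  (i <= j)%N -> G^`(j) \subset G^`(i).
Proof.
move=> /subnKC <-; elim: (j - i)%N => [|k IHk]; first by rewrite addn0.
by rewrite addnS (subset_trans (der_subS _ _)).
Qed.

Lemma derD (gT : finGroupType) (G : {group gT}) (i j : nat) :
  G^`(i + j) = (G^`(i))^`(j).
Proof. by elim: j => [|j IHj]; rewrite ?addn0 // addnS !dergSn IHj. Qed.

(** The derived series of a solvable group strictly loses elements until it is trivial. *)
Lemma der_solvable_card (gT : finGroupType) (G : {group gT}) (m : nat) :
  solvable G -> (#|G| <= m)%N -> G^`(m) = 1.
Proof.
move=> solG leGm.
have H k : G^`(k) = 1 \/ (#|G^`(k)| + k <= #|G|)%N.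
  elim: k => [|k [IHk|IHk]]; first by right; rewrite addn0.
    by left; apply/trivgP; move: (der_subS k G); rewrite IHk.
  have [G1|ntG] := eqVneq G^`(k) 1.
    by left; apply/trivgP; move: (der_subS k G); rewrite G1.
  right; rewrite addnS -addSn; apply: leq_trans IHk; rewrite leq_add2r.
  exact: proper_card (sol_der1_proper solG (der_sub k G) ntG).
case: (H m) => // lem; have := leq_trans lem leGm.
by rewrite -[X in (_ <= X)%N]add0n leq_add2r leqNgt cardG_gt0.
Qed.

(** [G] acts on the cosets of [H] through a solvable group of order at most [k]!, whose derived
    series is trivial after as many steps. So [G^](k[!)] fixes the coset [H], whose stabiliser is
    [H]. *)
Lemma der_sub_index (gT : finGroupType) (G H : {group gT}) (k : nat) :
  solvable G -> H \subset G -> (#|G : H| <= k)%N -> G^`(k`!) \subset H.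
Proof.
move=> solG sHG leGHk.
have actsG : [acts G, on rcosets H G | 'Rs] by apply: actsRs_rcosets.
pose to := <[actsG]>%act.
have sImP : actperm to @* G \subset [set s | perm_on (rcosets H G) s].
  apply/subsetP=> s /morphimP[g _ Gg ->]; rewrite inE; apply/subsetP=> X.
  rewrite inE actpermE /= /actby; case: ifP => [/andP[]//|_].
  by rewrite eqxx.
have Im1 : (actperm to @* G)^`(k`!) = 1.
  apply: der_solvable_card; first exact: morphim_sol.
  apply: leq_trans (subset_leq_card sImP) _.
  rewrite cardsE card_perm; exact: leq_fact.
have sG : G^`(k`!) \subset G by apply: der_sub.
apply/subsetP=> g Gkg.
have Gg : g \in G by apply: (subsetP sG).
have : actperm to g \in (actperm to @* G)^`(k`!).
  rewrite -morphim_der //; apply: mem_morphim => //.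
rewrite Im1 => /set1P /permP /(_ (H : {set gT})).
rewrite actpermE perm1 /= actbyE //; last first.
  by apply/rcosetsP; exists 1; rewrite ?group1 ?rcoset1.
by move=> HgH; rewrite -HgH /= rcosetE; apply: rcoset_refl.
Qed.

(** * Derived length of finite solvable linear groups *)

Local Open Scope ring_scope.

(** Apply [T x] to an expression of [v i] in the other vectors and subtract [chi i x] times it: by
    independence of the others, a nonzero coefficient would force two characters to agree at every
    [x]. *)
Lemma eigenvectors_free (F : fieldType) (V : vectType F) (X : Type)
    (T : X -> {linear V -> V}) (I : eqType) (v : I -> V) (chi : I -> X -> F)
    (s : seq I) :
    uniq s -> {in s, forall i, v i != 0} ->
    {in s, forall i x, T x (v i) = chi i x *: v i} ->
    {in s &, forall i j, (forall x, chi i x = chi j x) -> i = j} ->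
  free [seq v i | i <- s].
Proof.
elim: s => [|i s IHs] /=; first by rewrite nil_free.
move=> /andP[nsi us] nz eig inj; rewrite free_cons.
have frs : free [seq v j | j <- s].
  apply: IHs => // [j js|j js|j k js ks];
    [apply: nz | apply: eig | apply: inj]; by rewrite inE ?js ?ks orbT.
rewrite frs andbT; apply/negP => vi_s.
have si : i \in i :: s by rewrite mem_head.
pose X0 := in_tuple [seq v j | j <- s].
have vi_X : v i \in <<X0>>%VS by [].
have Dvi := coord_span vi_X.
have szs : size X0 = size s by rewrite size_map.
have nthv (k : 'I_(size X0)) : X0`_k = v (nth i s k).
  by rewrite (nth_map i) // -szs.
have ins (k : 'I_(size X0)) : nth i s k \in s by rewrite mem_nth // -szs.
have c0 (k : 'I_(size X0)) : coord X0 k (v i) = 0.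
  apply/eqP; apply: contraNT nsi => nzc.
  suff -> : i = nth i s k by [].
  apply: inj => //; first by rewrite inE ins orbT.
  move=> x.
  have : \sum_(j < size X0) (coord X0 j (v i) *
           (chi (nth i s j) x - chi i x)) *: X0`_j = 0.
    have Tvi : T x (v i) =
        \sum_(j < size X0) (coord X0 j (v i) * chi (nth i s j) x) *: X0`_j.
      rewrite {1}Dvi linear_sum; apply: eq_bigr => j _.
      by rewrite linearZ /= -/X0 nthv eig ?scalerA // inE ins orbT.
    have cvi : chi i x *: v i =
        \sum_(j < size X0) (coord X0 j (v i) * chi i x) *: X0`_j.
      rewrite {1}Dvi scaler_sumr; apply: eq_bigr => j _.
      by rewrite scalerA mulrC.
    have := eig i si x; rewrite Tvi cvi => /eqP; rewrite -subr_eq0 -sumrB.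
    move/eqP => e; rewrite -[RHS]e; apply: eq_bigr => j _.
    by rewrite mulrBr scalerBl.
  have /freeP fr : free X0 by [].
  move/fr/(_ k)/eqP.
  by rewrite mulf_eq0 (negPf nzc) /= subr_eq0 => /eqP.
have := nz i si; rewrite Dvi big1 ?eqxx // => k _.
by rewrite -/X0 c0 scale0r.
Qed.

(** Representatives of distinct cosets of [C] have distinct characters, hence independent
    eigenvectors. *)
Lemma eigenvectors_index (F : fieldType) (V : vectType F) (X : Type)
    (T : X -> {linear V -> V}) (gT : finGroupType) (G C : {group gT})
    (v : gT -> V) (chi : gT -> X -> F) :
    C \subset G -> {in G, forall g, v g != 0} ->
    {in G, forall g x, T x (v g) = chi g x *: v g} ->
    {in G &, forall g h, (forall x, chi g x = chi h x) -> (g * h^-1)%g \in C} ->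
  (#|G : C| <= \dim {:V})%N.
Proof.
move=> sCG nz eig inj.
have reprG (A : {set gT}) : A \in rcosets C G -> repr A \in G.
  case/rcosetsP=> g Gg ->; have /rcosetP[c Cc ->] := mem_repr_rcoset C g.
  by rewrite groupM // (subsetP sCG).
have reprE (A : {set gT}) : A \in rcosets C G -> A = C :* repr A.
  by case/rcosetsP=> g Gg ->; rewrite rcoset_repr.
have : free [seq v (repr A) | A <- enum (rcosets C G)].
  apply: (@eigenvectors_free F V X T _ (fun A => v (repr A))
    (fun A => chi (repr A)) _ (enum_uniq _)) => [A|A|A B].
  - by rewrite mem_enum => /reprG/nz.
  - by rewrite mem_enum => /reprG/eig.
  - rewrite !mem_enum => RA RB /(inj _ _ (reprG _ RA) (reprG _ RB)).
    rewrite -mem_rcoset => /rcoset_eqP.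
    by rewrite -!reprE.
rewrite /free size_map -cardE => /eqP e; rewrite /indexg -e.
by rewrite dimvS // subvf.
Qed.

Section Rep.
Variables (F : fieldType) (gT : finGroupType) (G : {group gT}) (n : nat).
Variable rG : mx_representation F G n.

Lemma commg_rker (x y : gT) : x \in G -> y \in G ->
  rG x *m rG y = rG y *m rG x -> [~ x, y] \in rker rG.
Proof.
move=> Gx Gy cxy; apply/rkerP; split; first by rewrite groupR.
have -> : [~ x, y] = ((y * x)^-1 * (x * y))%g.
  by rewrite invMg !mulgA /commg /conjg !mulgA.
rewrite repr_mxM ?groupV ?groupM // repr_mxV ?groupM // !repr_mxM // cxy.
by rewrite mulVmx // unitmx_mul !repr_mx_unit.
Qed.

Lemma der_rker_mxmodule (U : 'M_n) (modU : mxmodule rG U) (k : nat) :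
    (G^`(k) \subset rker (submod_repr modU))%g ->
    (G^`(k) \subset rker (factmod_repr modU))%g ->
  (G^`(k.+1) \subset rker rG)%g.
Proof.
move=> ks kf.
have sub1 x : x \in (G^`(k))%g -> (rG x - 1%:M <= U)%MS.
  move=> kx; have /rkerP[Gx fx] := subsetP kf x kx.
  have := in_factmodJ modU 1%:M Gx; rewrite fx mulmx1 mul1mx => e.
  by rewrite -in_factmod_eq0 linearB /= e subrr.
have U0 x : x \in (G^`(k))%g -> U *m (rG x - 1%:M) = 0.
  move=> kx; have /rkerP[Gx fx] := subsetP ks x kx.
  have := val_submodJ modU 1%:M Gx; rewrite fx mulmx1 => e.
  have : (U <= val_submod (1%:M : 'M_(\rank U)))%MS by rewrite val_submod1.
  case/submxP=> D ->; rewrite -mulmxA mulmxBr mulmx1.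
  by rewrite -e subrr mulmx0.
have mul0 x y : x \in (G^`(k))%g -> y \in (G^`(k))%g ->
    (rG x - 1%:M) *m (rG y - 1%:M) = 0.
  by move=> /sub1/submxP[D ->] /U0 e; rewrite -mulmxA e mulmx0.
have mulE x y : x \in (G^`(k))%g -> y \in (G^`(k))%g ->
    rG x *m rG y = rG x + rG y - 1%:M.
  move=> kx ky; have := mul0 x y kx ky.
  rewrite mulmxBl !mulmxBr !mulmx1 !mul1mx => /eqP; rewrite subr_eq0 => /eqP e.
  by rewrite -[LHS](subrK (rG x)) e addrC addrA.
rewrite dergSn gen_subG; apply/subsetP=> _ /imset2P[x y kx ky ->].
have sG := subsetP (der_sub k G).
by apply: commg_rker; rewrite ?sG // !mulE // [rG y + _]addrC.
Qed.

Lemma der1_rker_scalar : G \subset rcenter rG -> (G^`(1) \subset rker rG)%g.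
Proof.
move=> sGZ; rewrite dergSn gen_subG; apply/subsetP=> _ /imset2P[x y Gx Gy ->].
apply: commg_rker => //.
have:= subsetP sGZ x Gx; rewrite inE => /andP[_ /is_scalar_mxP[a ->]].
by rewrite scalar_mxC.
Qed.

End Rep.

Lemma stable_eigenvector (F : closedFieldType) (m n : nat) (U : 'M[F]_(m, n))
    (A : 'M_n) :
  U != 0 -> stablemx U A -> exists a, (eigenspace A a :&: U)%MS != 0.
Proof.
move=> nzU stU; pose W := row_base U.
have fW : row_free W by apply: row_base_free.
have : (W *m A <= W)%MS.
  by rewrite !eq_row_base (eqmxMr A (eq_row_base U)).
case/submxP=> B DB.
have : size (char_poly B) != 1%N.
  by rewrite size_char_poly eqSS mxrank_eq0.
case/closed_rootP=> a; rewrite -eigenvalue_root_char => /eigenvalueP[v vB nzv].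
exists a; apply/rowV0Pn; exists (v *m W).
  rewrite sub_capmx; apply/andP; split.
    by apply/eigenspaceP; rewrite -mulmxA DB mulmxA vB scalemxAl.
  by rewrite -(eq_row_base U) submxMl.
apply: contraNneq nzv => vW0; apply/eqP.
by apply: (row_free_inj fW); rewrite vW0 mul0mx.
Qed.

(** Induction on the rank of a stable [U]. If every [A x] is scalar on [U], any nonzero row serves;
    otherwise an eigenspace of some [A x] cuts [U] to a smaller nonzero space, stable because the
    matrices commute. *)
Lemma common_eigenvector (F : closedFieldType) (n : nat) (X : Type)
    (A : X -> 'M[F]_n.+1) :
    (forall x y, A x *m A y = A y *m A x) ->
  exists v : 'rV_n.+1, v != 0 /\ forall x, exists a, v *m A x = a *: v.
Proof.
move=> cA.
suff H r (U : 'M_n.+1) : (\rank U <= r)%N -> U != 0 ->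
    (forall x, stablemx U (A x)) ->
    exists v : 'rV_n.+1, v != 0 /\ forall x, exists a, v *m A x = a *: v.
  apply: (H n.+1 1%:M) => [||x]; first by rewrite mxrank1.
    by rewrite -mxrank_eq0 mxrank1.
  exact: submx1.
elim: r U => [|r IHr] U leU nzU stU.
  by move: nzU; rewrite -mxrank_eq0 -leqn0 leU.
have [all|] := pselect (forall x, exists a, U *m A x = a *: U).
  exists (nz_row U); split; first by rewrite nz_row_eq0.
  move=> x; have [a Ua] := all x; exists a.
  by have /submxP[D ->] := nz_row_sub U; rewrite -mulmxA Ua scalemxAr.
case/existsNP=> x nx; have [a nzW] := stable_eigenvector nzU (stU x).
apply: (IHr (eigenspace (A x) a :&: U)%MS) => //.
  rewrite -ltnS; apply: leq_trans leU.
  rewrite ltn_neqAle mxrankS ?capmxSr // andbT.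
  apply/negP => /eqP e; apply: nx; exists a; apply/eigenspaceP.
  have := mxrank_leqif_sup (capmxSr (eigenspace (A x) a) U).
  by case=> _; rewrite e eqxx sub_capmx => /esym/andP[].
move=> y; rewrite sub_capmx; apply/andP; split.
  apply/eigenspaceP; rewrite -mulmxA (cA y x) mulmxA.
  have /eigenspaceP -> := capmxSl (eigenspace (A x) a) U.
  by rewrite scalemxAl.
exact: submx_trans (submxMr _ (capmxSr _ _)) (stU y).
Qed.

Section Reducible.
Variables (F : closedFieldType) (gT : finGroupType) (G : {group gT}) (n : nat).
Variable rG : mx_representation F G n.+1.

Let JE x g : x \in G -> g \in G ->
  rG (x ^ g)%g = invmx (rG g) *m rG x *m rG g.
Proof.
by move=> Gx Gg; rewrite /conjg !repr_mxM ?groupM ?groupV // repr_mxV // mulmxA.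
Qed.

Let JC x g : x \in G -> g \in G -> rG x *m rG g = rG g *m rG (x ^ g)%g.
Proof.
by move=> Gx Gg; rewrite -!repr_mxM ?groupJ // -conjgC.
Qed.

Let J_eq x y g : x \in G -> y \in G -> g \in G ->
  rG x = rG y -> rG (x ^ g)%g = rG (y ^ g)%g.
Proof. by move=> Gx Gy Gg e; rewrite !JE // e. Qed.

Let rcenterP x : reflect (x \in G /\ exists a, rG x = a%:M) (x \in rcenter rG).
Proof.
rewrite inE; apply: (iffP andP) => -[Gx]; first 
  by case/is_scalar_mxP=> a e; split=> //; exists a.
by case=> a ->; split=> //; apply: scalar_mx_is_scalar.
Qed.

Let full_eigenspace x a :
  x \in G -> x \notin rcenter rG -> ~~ (1%:M <= eigenspace (rG x) a)%MS.
Proof.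
move=> Gx; apply: contra => /eigenspaceP; rewrite mul1mx => e.
by rewrite inE Gx e scalemx1 scalar_mx_is_scalar.
Qed.

Let rank_ltn (U : 'M[F]_n.+1) : ~~ (1%:M <= U)%MS -> (\rank U <= n)%N.
Proof. by rewrite sub1mx /row_full -ltnS ltn_neqAle rank_leq_row => ->. Qed.

(** The preimage in [B] of the centre of the image of [B]. *)
Let max_commuting (B : {group gT}) :=
  [set x in B | [forall c in B, rG x *m rG c == rG c *m rG x]].

Let max_commutingP (B : {group gT}) x : reflect
  (x \in B /\ {in B, forall c, rG x *m rG c = rG c *m rG x})
  (x \in max_commuting B).
Proof.
rewrite inE; apply: (iffP andP) => -[Bx H]; split=> //.
  by move=> c Bc; apply/eqP; move/forall_inP: H; apply.
by apply/forall_inP => c Bc; apply/eqP/H.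
Qed.

(** Clifford's argument: [B1] has a common eigenvector [v] with character [chi], and each
    [v *m rG g] is an eigenvector for a conjugate of [chi]. The stabiliser [C] of [chi] thus has
    index at most the degree, and it preserves the common eigenspace of [chi], which is proper
    because [b] is not scalar. *)
Lemma reducible_commuting (B : {group gT}) (b : gT) :
    B <| G -> b \in B -> b \notin rcenter rG ->
    {in B, forall c, rG b *m rG c = rG c *m rG b} ->
  exists (C : {group gT}) (U : 'M_n.+1),
    [/\ C \subset G, (#|G : C| <= n.+1)%N, C \subset rstabs rG U, U != 0
      & (\rank U <= n)%N].
Proof.
move=> nBG Bb nsb cb; pose B1 := max_commuting B.
have /andP[sBG nBG'] := nBG.
have B1b : b \in B1 by apply/max_commutingP.
have B1B x : x \in B1 -> x \in B by case/max_commutingP.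
have B1G x : x \in B1 -> x \in G by move/B1B/(subsetP sBG).
have B1J x g : x \in B1 -> g \in G -> (x ^ g)%g \in B1.
  move=> /max_commutingP[Bx cx] Gg; apply/max_commutingP; split.
    by rewrite memJ_norm // (subsetP nBG').
  have Gx := subsetP sBG x Bx.
  move=> c Bc; have Gc := subsetP sBG c Bc.
  have Bc' : (c ^ g^-1)%g \in B by rewrite memJ_norm ?groupV // (subsetP nBG').
  have Gc' := subsetP sBG _ Bc'.
  rewrite -[in LHS](conjgKV g c) -[in RHS](conjgKV g c).
  rewrite -!repr_mxM ?groupJ ?groupV // -!conjMg.
  apply: J_eq => //; [exact: groupM | exact: groupM |].
  by rewrite repr_mxM // [RHS]repr_mxM // cx.
pose X := {x | x \in B1}.
have [v [nzv eigv]] : exists v : 'rV_n.+1, v != 0 /\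
    forall x : X, exists a, v *m rG (val x) = a *: v.
  apply: common_eigenvector => x y.
  have /max_commutingP[_ ->//] := valP x; exact: B1B (valP y).
have [chi0 chiE] := choice eigv.
pose chi x := if insub x is Some x' then chi0 x' else 0.
have vE x : x \in B1 -> v *m rG x = chi x *: v.
  by move=> B1x; rewrite /chi insubT -chiE.
pose C := [set g in G | [forall x in B1, chi (x ^ g)%g == chi x]].
have CP g : reflect (g \in G /\ {in B1, forall x, chi (x ^ g)%g = chi x})
    (g \in C).
  rewrite inE; apply: (iffP andP) => -[Gg H]; split=> //.
    by move=> x B1x; apply/eqP; move/forall_inP: H; apply.
  by apply/forall_inP => x B1x; apply/eqP/H.
have gC : group_set C.
  apply/group_setP; split.
    by apply/CP; split=> // x _; rewrite conjg1.
  move=> g h /CP[Gg Cg] /CP[Gh Ch]; apply/CP; split; first exact: groupM.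
  by move=> x B1x; rewrite conjgM Ch ?Cg // B1J.
have sCG : Group gC \subset G by apply/subsetP => g /CP[].
pose U : 'M_n.+1 := (\bigcap_(x in B1) eigenspace (rG x) (chi x))%MS.
have UP m (W : 'M_(m, n.+1)) : reflect
    {in B1, forall x, W *m rG x = chi x *: W} (W <= U)%MS.
  apply: (iffP sub_bigcapmxP) => H x B1x; first exact/eigenspaceP/H.
  exact/eigenspaceP/H.
exists (Group gC), U; split=> //.
- have := @eigenvectors_index F 'rV[F]_n.+1 X
    (fun x => mulmxr (rG (val x))) gT G (Group gC) (fun g => v *m rG g)
    (fun g x => chi (val x ^ g^-1)%g) sCG.
  rewrite dimvf /dim /= mul1n; apply => [g Gg|g Gg x|g h Gg Gh e] /=.
  + by apply: contraNneq nzv => e; rewrite -[v](repr_mxK rG Gg) e mul0mx.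
  + have Gx := B1G _ (valP x).
    rewrite scalemxAl -vE ?B1J ?groupV ?(valP x) // -!mulmxA.
    by rewrite [in RHS]JC ?groupJ ?groupV // conjgKV.
  apply/CP; split; first by rewrite groupM ?groupV.
  move=> x B1x; have B1xg := B1J x g B1x Gg.
  by have /= := e (exist (fun y => y \in B1) _ B1xg); rewrite conjgK conjgM.
- apply/subsetP => g Cg; have /CP[Gg Hg] := Cg.
  have /CP[Ggi Hgi] : (g^-1)%g \in C by apply: (groupVr (G := Group gC)).
  rewrite inE Gg; apply/UP => x B1x; have Gx := B1G _ B1x.
  have := JC (x := (x ^ g^-1)%g) (g := g); rewrite conjgKV => e.
  rewrite -mulmxA -e ?groupJ // mulmxA.
  have /UP -> := submx_refl U; last exact: B1J.
  by rewrite Hgi // scalemxAl.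
- apply: contraNneq nzv => U0; have : (v <= U)%MS by apply/UP.
  by rewrite U0 submx0.
apply: rank_ltn; apply: contra (full_eigenspace (chi b) (B1G _ B1b) nsb).
by move=> s1U; apply/eigenspaceP; apply/UP: B1b.
Qed.

(** Here the eigenvectors are matrices: as [B'] is scalar, conjugation by [c] in [B] multiplies each
    [rG (b ^ g)] by a scalar [chi g c]. This bounds the index of [C] by the dimension of the matrix
    algebra. Elements of [C] conjugate [rG b] to scalar multiples of itself, so [C'] centralises
    [rG b] and preserves its eigenspaces. *)
Lemma reducible_noncommuting (B : {group gT}) (b : gT) :
    B <| G -> (B^`(1) \subset rcenter rG)%g -> b \in B -> b \notin rcenter rG ->
    {in B, forall x, {in B, forall c, rG x *m rG c = rG c *m rG x} ->
       x \in rcenter rG} ->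
  exists (C : {group gT}) (U : 'M_n.+1),
    [/\ C \subset G, (#|G : C| <= n.+1 ^ 2)%N,
      (C^`(1) \subset rstabs rG U)%g, U != 0 & (\rank U <= n)%N].
Proof.
move=> nBG sB'Z Bb nsb maxB; have /andP[sBG nBG'] := nBG.
have BG x : x \in B -> x \in G by apply: (subsetP sBG).
have BJ x g : x \in B -> g \in G -> (x ^ g)%g \in B.
  by move=> Bx Gg; rewrite memJ_norm // (subsetP nBG').
have Gb := BG b Bb.
pose C := [set g in G | [~ b, g] \in rcenter rG].
have CE g : (g \in C) = (g \in G) && ([~ b, g] \in rcenter rG).
  by rewrite in_set.
have /andP[sZG nZG] := rcenter_normal rG.
have ZJ x g : x \in rcenter rG -> g \in G -> (x ^ g)%g \in rcenter rG.
  by move=> Zx Gg; rewrite memJ_norm // (subsetP nZG).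
have gC : group_set C.
  apply/group_setP; split; first by rewrite CE commg1 !group1.
  move=> g h; rewrite !CE => /andP[Gg Zg] /andP[Gh Zh].
  by rewrite groupM // commgMJ groupM ?ZJ.
have sCG : Group gC \subset G by apply/subsetP => g; rewrite CE => /andP[].
(* The commutator acts as a scalar matrix, so one diagonal entry determines it. *)
pose chi g c := (rG [~ (b ^ g)%g, c]) ord0 ord0.
have chiE g c : g \in G -> c \in B ->
    rG ((b ^ g) ^ c)%g = chi g c *: rG (b ^ g)%g.
  move=> Gg Bc; have Bbg := BJ b g Bb Gg.
  have : [~ (b ^ g)%g, c] \in rcenter rG.
    by apply: (subsetP sB'Z); rewrite derg1 mem_commg.
  have Gbg := BG _ Bbg; have Gc := BG _ Bc.
  case/rcenterP => Gr [a ea]; rewrite conjg_mulR repr_mxM // /chi ea.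
  by rewrite !mxE eqxx mulr1n -mul_mx_scalar.
have C1 g h : g \in C -> h \in C -> rG (b ^ (g * h))%g = rG (b ^ (h * g))%g.
  have H g' h' : g' \in C -> h' \in C ->
      exists a1 a2, [/\ rG [~ b, g'] = a1%:M, rG [~ b, h'] = a2%:M &
        rG (b ^ (g' * h'))%g = rG b *m a2%:M *m a1%:M].
    rewrite !CE => /andP[Gg Zg] /andP[Gh Zh].
    have /rcenterP[_ [a1 e1]] := Zg; have /rcenterP[_ [a2 e2]] := Zh.
    exists a1, a2; split=> //.
    have Gr1 : [~ b, g'] \in G by rewrite groupR.
    have Gr2 : [~ b, h'] \in G by rewrite groupR.
    have -> : (b ^ (g' * h') = b * [~ b, h'] * [~ b, g'] ^ h')%g.
      by rewrite conjgM [(b ^ g')%g]conjg_mulR conjMg [(b ^ h')%g]conjg_mulR.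
    rewrite repr_mxM ?(groupJ Gr1) ?(groupM Gb) // [rG (b * _)%g]repr_mxM // e2.
    rewrite JE // e1; congr (_ *m _).
    by rewrite scalar_mxC -(mulmxA a1%:M) mulVmx ?mulmx1 ?repr_mx_unit.
  move=> Cg Ch; have [a1 [a2 [e1 e2 ->]]] := H g h Cg Ch.
  have [a3 [a4 [e3 e4 ->]]] := H h g Ch Cg.
  by rewrite -e1 -e2 -e3 -e4 -!mulmxA e1 e2 scalar_mxC.
have stb : (C^`(1))%g \subset rcent rG (rG b).
  rewrite gen_subG; apply/subsetP => _ /imset2P[g h Cg Ch ->].
  have Gg : g \in G by move: Cg; rewrite CE => /andP[].
  have Gh : h \in G by move: Ch; rewrite CE => /andP[].
  rewrite inE groupR //=; apply/eqP; rewrite JC ?groupR //; congr (_ *m _).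
  have -> : [~ g, h] = ((g^-1 * h^-1) * (h^-1 * g^-1)^-1)%g.
    by rewrite invMg !invgK /commg /conjg !mulgA.
  rewrite conjgM.
  have -> : rG ((b ^ (g^-1 * h^-1)) ^ (h^-1 * g^-1)^-1)%g =
            rG ((b ^ (h^-1 * g^-1)) ^ (h^-1 * g^-1)^-1)%g.
    apply: J_eq; rewrite ?groupJ ?groupM ?groupV ?groupM ?groupV //.
    by apply: C1; apply: (groupVr (G := Group gC)).
  by rewrite conjgK.
have [a nzU] : exists a, (eigenspace (rG b) a :&: 1%:M)%MS != 0.
  by apply: stable_eigenvector; rewrite ?submx1 // -mxrank_eq0 mxrank1.
rewrite capmx1 in nzU.
exists (Group gC), (eigenspace (rG b) a); split=> //.
- have := @eigenvectors_index F 'M[F]_n.+1 {c | c \in B}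
    (fun c => mulmxr (rG (val c)) \o mulmx (invmx (rG (val c))))
    gT G (Group gC) (fun g => rG (b ^ g)%g) (fun g c => chi g (val c)) sCG.
  rewrite dimvf /dim /=; apply => [g Gg|g Gg [c Bc]|g h Gg Gh e] /=.
  + apply/eqP => e; have := repr_mx_unitr rG (groupJ Gb Gg).
    by rewrite e unitr0.
  + by have Gc := BG c Bc; rewrite -JE ?groupJ // chiE.
  (* If the characters of [g] and [h] agree, [t] commutes with [B] under [rG], so it is scalar by
     [maxB]; [[~ b, g * h^-1]] is a conjugate of [t]. *)
  pose t := (b ^ g * (b ^ h)^-1)%g.
  have Bt : t \in B by rewrite groupM ?groupV ?BJ.
  have Gbh : (b ^ h)%g \in G by rewrite groupJ.
  have tE : (b ^ g)%g = (t * b ^ h)%g by rewrite mulgKV.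
  have Zt : t \in rcenter rG.
    apply: maxB => // c Bc; have Gc := BG c Bc; have Gt := BG t Bt.
    rewrite JC //; congr (_ *m _).
    have uh : rG ((b ^ h) ^ c)%g \in unitmx by rewrite repr_mx_unit ?groupJ.
    rewrite -[LHS](mulmxK uh) -[RHS](mulmxK uh); congr (_ *m _).
    rewrite -repr_mxM ?groupJ // -conjMg -tE !chiE //.
    by have /= -> := e (exist (fun y => y \in B) c Bc);
      rewrite -scalemxAr -repr_mxM // -tE.
  rewrite [_ \in _]CE groupM ?groupV //=.
  have -> : [~ b, (g * h^-1)%g] = (t ^ (h^-1 * b))%g.
    by rewrite commgEl conjgM tE conjMg conjgK conjgM.
  by rewrite ZJ // groupM ?groupV.
- apply: subset_trans stb _; apply/subsetP => y.
  rewrite !inE => /andP[-> /eqP e].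
  apply/eigenspaceP; rewrite -mulmxA -e mulmxA.
  by have /eigenspaceP -> := submx_refl (eigenspace (rG b) a);
    rewrite scalemxAl.
exact/rank_ltn/full_eigenspace.
Qed.

End Reducible.

(* In degree [n], [(n ^ 2)`!] steps lead into a subgroup of index at most     *)
(* [n ^ 2], one more into its derived subgroup, which is reducible; the last  *)
(* [.+1] accounts for the abelian group of block unitriangular matrices.      *)
Fixpoint zassenhaus_bound (n : nat) : nat :=
  if n is n'.+1 then ((n ^ 2)`!).+1 + (zassenhaus_bound n').+1 else 0.

Lemma zassenhaus_bound_homo : {homo zassenhaus_bound : m n / (m <= n)%N}.
Proof.
apply: homo_leq => [n|m n p|n]; [exact: leqnn | exact: leq_trans |].
by rewrite /= -addSnnS leq_addl.
Qed.

Lemma reducible_solvable (F : closedFieldType) (gT : finGroupType)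
    (G : {group gT}) (n : nat) (rG : mx_representation F G n.+1) :
    solvable G -> ~~ (G \subset rcenter rG) ->
  exists (C : {group gT}) (U : 'M_n.+1),
    [/\ C \subset G, (G^`((n.+1 ^ 2)`!.+1) \subset C)%g, C \subset rstabs rG U,
      U != 0 & (\rank U <= n)%N].
Proof.
move=> solG nsG.
(* The last nonscalar term of the derived series serves as [B]: it is normal and its derived
   subgroup is scalar. *)
have exP : exists i, (G^`(i) \subset rcenter rG)%g.
  by have /derivedP[i Gi1] := solG; exists i; rewrite Gi1 sub1G.
case: (ex_minnP exP) => -[|i] sZi mini; first by case/negP: nsG.
have /subsetPn[b Bb nsb] : ~~ (G^`(i) \subset rcenter rG)%g.
  by apply/negP => /mini; rewrite ltnn.
have nBG : ([group of (G^`(i))%g] <| G)%g by apply: der_normal.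
have [[a [Ba nsa ca]]|ncom] := pselect (exists a, [/\ a \in (G^`(i))%g,
    a \notin rcenter rG &
    {in (G^`(i))%g, forall c, rG a *m rG c = rG c *m rG a}]).
  have [C [U [sCG iC stU nzU rkU]]] := reducible_commuting nBG Ba nsa ca.
  exists C, U; split=> //; apply: subset_trans (der_subS _ _) _.
  apply: der_sub_index => //; apply: leq_trans iC _.
  by rewrite -{1}[n.+1]expn1 leq_pexp2l.
have [|C [U [sCG iC stU nzU rkU]]] :=
    reducible_noncommuting nBG sZi Bb nsb.
  move=> x Bx cx; apply/negPn/negP => nsx; apply: ncom; by exists x.
exists [group of (C^`(1))%g], U; split=> //.
  exact: subset_trans (der_sub _ _) sCG.
have sGC := der_sub_index solG sCG iC.
by rewrite dergSn; apply: commgSS.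
Qed.

Lemma zassenhaus_closed (F : closedFieldType) (gT : finGroupType) (n : nat)
    (G : {group gT}) (rG : mx_representation F G n) :
  solvable G -> (G^`(zassenhaus_bound n) \subset rker rG)%g.
Proof.
suff H N : forall n (G : {group gT}) (rG : mx_representation F G n),
    (n <= N)%N -> solvable G -> (G^`(zassenhaus_bound n) \subset rker rG)%g.
  exact: H (leqnn n).
elim: N => [|N IHN] {}n {}G {}rG.
  rewrite leqn0 => /eqP n0 _; move: rG; rewrite n0 => rG.
  by apply/subsetP => x Gx; apply/rkerP; split=> //; apply/matrixP => -[].
case: n rG => [|n] rG leN solG.
  by apply/subsetP => x Gx; apply/rkerP; split=> //; apply/matrixP => -[].
have [sGZ|nsG] := boolP (G \subset rcenter rG).
  exact: subset_trans (der_sub_leq _ _) (der1_rker_scalar sGZ).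
have [C [U [sCG sGC stU nzU rkU]]] := reducible_solvable solG nsG.
have solC := solvableS sCG solG.
pose rC := subg_repr rG sCG.
have modU : mxmodule rC U.
  apply/mxmoduleP => x Cx; have := subsetP stU x Cx.
  by rewrite inE => /andP[].
have leC m (rC' : mx_representation F C m) : (m <= n)%N ->
    (C^`(zassenhaus_bound n) \subset rker rC')%g.
  move=> le_mn; apply: subset_trans (IHN _ _ rC' (leq_trans le_mn _) solC);
    last by [].
  exact/der_sub_leq/zassenhaus_bound_homo.
have sCK : (C^`((zassenhaus_bound n).+1) \subset rker rC)%g.
  apply: (der_rker_mxmodule (modU := modU)); apply: leC => //.
  rewrite mxrank_coker leq_subLR.
  by move: nzU; rewrite -mxrank_eq0 -lt0n -(leq_add2r n) add1n.
rewrite rker_subg in sCK.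
rewrite [zassenhaus_bound _]/= derD.
apply: subset_trans (dergS _ sGC) (subset_trans sCK (subsetIr _ _)).
Qed.

(** Extending scalars to an algebraic closure gives a faithful representation. *)
Lemma zassenhaus_GL (F : finFieldType) (n : nat) (H : {group {'GL_n.+1[F]}}) :
  solvable H -> (H^`(zassenhaus_bound n.+1) = 1)%g.
Proof.
move=> solH; have [L [f _]] := countable_algebraic_closure F.
have rP : mx_repr H (fun x => map_mx f (GLval x)).
  split=> [|x y Hx Hy]; first by rewrite GL_1E map_mx1.
  by rewrite GL_MxE map_mxM.
pose rH : mx_representation L H n.+1 := MxRepresentation rP.
apply/trivgP; apply: subset_trans (zassenhaus_closed rH solH) _.
apply/subsetP => x /rkerP[_ /= e]; apply/set1P; apply/val_inj.
have : map_mx f (GLval x) = map_mx f (GLval (1 : {'GL_n.+1[F]})%g).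
  by rewrite e GL_1E map_mx1.
exact: map_mx_inj.
Qed.

(** * Specialising finitely generated rings to finite fields *)

(** The subring meant is the image of [iota]; a [phi] that kills the kernel of [iota] amounts to a
    homomorphism on that image. *)
Definition residually_finite_field (R : idomainType) (K : fieldType)
    (iota : {rmorphism R -> K}) : Prop :=
  forall a, iota a != 0 -> exists (F : finFieldType) (phi : {rmorphism R -> F}),
    (forall r, iota r = 0 -> phi r = 0) /\ phi a != 0.

Lemma residually_finite_field_int (K : fieldType)
    (iota : {rmorphism int -> K}) : residually_finite_field iota.
Proof.
have iotaE z : iota z = z%:~R by rewrite -[z in LHS]intz rmorph_int.
move=> a; rewrite iotaE => nza.
have [[p Kp]|nK] := pselect (exists p, p \in [pchar K]).
  have pr_p := pcharf_prime Kp; have Fp := pchar_Fp pr_p.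
  exists 'F_p, (intmul 1); split=> [r|].
    rewrite iotaE => /eqP; rewrite -(dvdz_pcharf Kp) => pr.
    by apply/eqP; rewrite -(dvdz_pcharf Fp).
  by move: nza; rewrite -(dvdz_pcharf Kp) -(dvdz_pcharf Fp).
(* In characteristic 0, a prime above [|a|] does not divide [a]. *)
have [p lt_ap pr_p] := prime_above `|a|%N; have Fp := pchar_Fp pr_p.
have K0 : [pchar K] =i pred0.
  by move=> q; apply/negP => Kq; apply: nK; exists q.
have nz_int z : (z%:~R == 0 :> K) = (z == 0).
  have /pcharf0P nz := K0.
  by case: z => m; rewrite ?NegzE ?mulrNz ?oppr_eq0 -?pmulrn nz.
exists 'F_p, (intmul 1); split=> [r|].
  by rewrite iotaE => /eqP; rewrite nz_int => /eqP ->.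
rewrite -(dvdz_pcharf Fp) dvdzE /= gtnNdvd // absz_gt0.
by rewrite -nz_int.
Qed.

Lemma finField_root_ext (F : finFieldType) (p : {poly F}) : (1 < size p)%N ->
  exists (E : finFieldType) (f : {rmorphism F -> E}) (x : E),
    root (map_poly f p) x.
Proof.
move=> sp; have nzp : p != 0 by rewrite -size_poly_gt0 ltnW.
have [L [rs Dp _]] := FinSplittingFieldFor nzp.
case: rs Dp => [|x rs] Dp.
  move: sp; have := eqp_size Dp.
  by rewrite big_nil size_poly1 size_map_poly => ->.
exists (FinFieldExtType L), (in_alg L), x.
by rewrite (eqp_root Dp) big_cons rootM root_XsubC eqxx.
Qed.

(** All elements of [F] may be roots of [p], but at a root of [p - 1] in an extension [p] has the
    value 1. *)
Lemma finField_nonroot_ext (F : finFieldType) (p : {poly F}) : p != 0 ->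
  exists (E : finFieldType) (f : {rmorphism F -> E}) (x : E),
    (map_poly f p).[x] != 0.
Proof.
move=> nzp; have [s1|s2] := leqP (size p) 1.
  exists F, idfun, 0; rewrite map_poly_id // (size1_polyC s1) hornerC.
  by apply: contraNneq nzp => e; rewrite (size1_polyC s1) e.
have [|E [f [x fx]]] := finField_root_ext (p := p - 1).
  by rewrite size_polyDl // size_polyN size_poly1.
exists E, f, x; move: fx; rewrite rmorphB rmorph1 /root hornerD hornerN hornerC.
by rewrite subr_eq0 => /eqP ->; apply: oner_neq0.
Qed.

Definition eval_at (R K : idomainType) (iota : {rmorphism R -> K}) (x : K) :
  {rmorphism {poly R} -> K} := horner_eval x \o map_poly iota.

Lemma eval_atE (R K : idomainType) (iota : {rmorphism R -> K}) (x : K) r :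
  eval_at iota x r = (map_poly iota r).[x].
Proof. by []. Qed.

Section Adjoin.
Variables (R : idomainType) (K : fieldType) (iota : {rmorphism R -> K}) (x : K).
Hypothesis resR : residually_finite_field iota.
Variable ev : {rmorphism {poly R} -> K}.
Hypothesis evE : forall r, ev r = (map_poly iota r).[x].

Let evC c : ev c%:P = iota c.
Proof. by rewrite evE map_polyC hornerC. Qed.

Let evZ c r : ev (c *: r) = iota c * ev r.
Proof. by rewrite -mul_polyC rmorphM evC. Qed.

Let map_ker (S : nzRingType) (phi : {rmorphism R -> S}) r :
  (forall c, iota c = 0 -> phi c = 0) -> map_poly iota r = 0 ->
  map_poly phi r = 0.
Proof.
move=> ker e; apply/polyP => i; rewrite coef_map coef0; apply: ker.
by have /polyP/(_ i) := e; rewrite coef_map coef0.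
Qed.

(** As [iota] need not be injective, a leading coefficient may vanish in [K]; dropping it excludes
    this for polynomials of minimal size. *)
Let strip r : iota (lead_coef r) = 0 -> r != 0 ->
  exists2 r' : {poly R}, (size r' < size r)%N &
    map_poly iota r' = map_poly iota r.
Proof.
move=> l0; rewrite -size_poly_gt0 => sr.
exists (\poly_(i < (size r).-1) r`_i).
  by apply: leq_ltn_trans (size_poly _ _) _; rewrite prednK.
apply/polyP => i; rewrite !coef_map coef_poly; case: ltnP => // le_i.
rewrite [LHS](rmorph0 iota); move: le_i; rewrite leq_eqVlt => /predU1P[<-|lt_i].
  exact/esym.
by rewrite nth_default ?[RHS](rmorph0 iota) // -(prednK sr).
Qed.

Let minimal_size (P : {poly R} -> Prop) : (exists r, P r) ->
  exists2 r, P r & forall r' : {poly R}, P r' -> (size r <= size r')%N.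
Proof.
case=> r Pr; have ex : exists n, `[< exists2 r : {poly R}, P r & size r = n >].
  by exists (size r); apply/asboolP; exists r.
case: (ex_minnP ex) => n /asboolP[r0 Pr0 <-] mini.
by exists r0 => // r' Pr'; apply: mini; apply/asboolP; exists r'.
Qed.

(** Keep one coefficient of [q] nonzero in a finite field, then send [x] to a point of an extension
    where the image of [q] does not vanish. *)
Let adjoin_transcendental : (forall r, ev r = 0 -> map_poly iota r = 0) ->
  residually_finite_field ev.
Proof.
move=> trans q nzq.
have nz_mq : map_poly iota q != 0.
  by apply: contraNneq nzq => e; rewrite evE e horner0.
pose i := (size (map_poly iota q)).-1.
have nzi : iota q`_i != 0.
  by rewrite -coef_map -/(lead_coef _) lead_coef_eq0.
have [F [phi [ker nz_phi]]] := resR nzi.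
have [|E [f [y nzy]]] := finField_nonroot_ext (p := map_poly phi q).
  by apply: contraNneq nz_phi => e; rewrite -coef_map e coef0.
exists E, (eval_at (f \o phi) y); split=> [r /trans r0|].
  by rewrite eval_atE map_poly_comp (map_ker ker r0) rmorph0 horner0.
by rewrite eval_atE map_poly_comp.
Qed.

Section Algebraic.
Variable p : {poly R}.
Hypotheses (evp : ev p = 0) (nzp : map_poly iota p != 0).
Hypothesis minp : forall r, ev r = 0 -> (size r < size p)%N ->
  map_poly iota r = 0.

Let nz_p : p != 0.
Proof. by apply: contraNneq nzp => ->; rewrite rmorph0. Qed.

Let lead_p : iota (lead_coef p) != 0.
Proof.
apply/eqP => /strip/(_ nz_p)[r lt_r er]; case/negP: nzp; rewrite -er.
by apply/eqP/minp; rewrite // evE er -evE.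
Qed.

Let size_p : (1 < size p)%N.
Proof.
rewrite ltnNge; apply: contra nzp => /size1_polyC e; move: evp.
by rewrite e evC map_polyC /= => ->.
Qed.

Let nz_lead k : iota (lead_coef p) ^+ k != 0.
Proof. exact: expf_neq0. Qed.

(* [ev q] is algebraic over [iota R]: a polynomial of minimal size whose      *)
(* value at [x] is a nonzero multiple of [ev q] is constant.                  *)
Let inverse_denominator q : ev q != 0 ->
  exists c v, iota c != 0 /\ iota c = ev v * ev q.
Proof.
move=> nzq.
have [|h [nzh [v hE]] minh] := minimal_size
    (P := fun h => ev h != 0 /\ exists v, ev h = ev v * ev q).
  by exists q; split=> //; exists 1; rewrite rmorph1 mul1r.
have nz_h : h != 0 by apply: contraNneq nzh => ->; rewrite rmorph0.
have lead_h : iota (lead_coef h) != 0.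
  apply/eqP => /strip/(_ nz_h)[r lt_r er].
  have er' : ev r = ev h by rewrite !evE er.
  have := minh r; rewrite er' leqNgt lt_r => /(_ _)/negP; apply => //.
  by split=> //; exists v.
have lt_hp : (size h < size p)%N.
  apply: leq_ltn_trans (minh (q %% p) _) (ltn_modpN0 _ nz_p).
  have := congr1 ev (Pdiv.WeakIdomain.divp_eq q p).
  rewrite evZ rmorphD rmorphM /= evp mulr0.
  rewrite add0r rmorphXn /= => <-; rewrite mulf_neq0 ?nz_lead //; split=> //.
  by exists (lead_coef p ^+ scalp q p)%:P; rewrite evC rmorphXn.
have [sh|sh] := leqP (size h) 1.
  exists h`_0, v; rewrite -evC -size1_polyC //; split=> //.
(* The value of the remainder at [x] is a multiple of [ev q], so it is 0 by minimality of [h]; then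
   the quotient vanishes at [x] too. Both are smaller than [p], so both are zero over [K], although
   a nonzero multiple of [p] is not. *)
have := Pdiv.WeakIdomain.divp_eq p h.
set k := scalp p h; set quo := p %/ h; set rem := p %% h.
move=> pE; have lt_rem : (size rem < size h)%N by apply: ltn_modpN0.
have evd : ev quo * ev h + ev rem = 0.
  by rewrite -rmorphM -rmorphD -pE evZ evp mulr0.
have rem0 : ev rem = 0.
  apply/eqP; apply: contraTT lt_rem => nzr; rewrite -leqNgt; apply: minh.
  split=> //; exists (- (quo * v)); rewrite rmorphN rmorphM mulNr -mulrA -hE.
  by apply/eqP; rewrite -addr_eq0 addrC evd.
have quo0 : ev quo = 0.
  move: evd; rewrite rem0 addr0 => /eqP.
  by rewrite mulf_eq0 (negPf nzh) orbF => /eqP.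
have mrem : map_poly iota rem = 0.
  by apply: minp => //; apply: ltn_trans lt_rem lt_hp.
have mquo : map_poly iota quo = 0.
  apply: minp => //; rewrite size_divp // ltn_subrL -subn1 subn_gt0 sh.
  by rewrite (ltnW size_p).
case/negP: nzp; have := congr1 (map_poly iota) pE.
rewrite rmorphD rmorphM /= mquo mul0r mrem addr0 map_polyZ rmorphXn => /eqP.
by rewrite scaler_eq0 expf_eq0 (negPf lead_h) andbF.
Qed.

(** Keep [c] and the leading coefficient of [p] nonzero in a finite field and send [x] to a root of
    the image of [p]. Pseudo-division by [p] shows that this respects the kernel of [ev], and [q]
    survives because it divides [c] in the image of [ev]. *)
Lemma adjoin_algebraic : residually_finite_field ev.
Proof.
move=> q nzq; have [c [v [nzc cE]]] := inverse_denominator nzq.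
have [|F [phi [ker]]] := resR (a := lead_coef p * c).
  by rewrite rmorphM mulf_neq0.
rewrite rmorphM mulf_eq0 negb_or => /andP[nzl nz_phic].
have [|E [f [y /rootP py]]] := finField_root_ext (p := map_poly phi p).
  by rewrite size_map_poly_id0.
have [psi psiE] : exists psi : {rmorphism {poly R} -> E},
    forall r, psi r = (map_poly f (map_poly phi r)).[y].
  by exists (eval_at (f \o phi) y) => r; rewrite eval_atE map_poly_comp.
have psiZ d r : psi (d *: r) = f (phi d) * psi r.
  by rewrite -mul_polyC rmorphM psiE !map_polyC hornerC.
have kpsi r : ev r = 0 -> psi r = 0.
  move=> r0; have rE := Pdiv.WeakIdomain.divp_eq r p.
  have m0 : ev (r %% p) = 0.
    have := congr1 ev rE; rewrite evZ r0 mulr0 rmorphD rmorphM /= evp mulr0.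
    by rewrite add0r.
  have := congr1 psi rE; rewrite psiZ rmorphD rmorphM /= [psi p]psiE py mulr0.
  rewrite add0r [psi (r %% p)]psiE (map_ker ker) ?rmorph0 ?horner0; last first.
    by apply: minp => //; apply: ltn_modpN0.
  move/eqP; rewrite mulf_eq0 !rmorphXn expf_eq0 fmorph_eq0 (negPf nzl) andbF.
  by move/eqP.
exists E, psi; split=> //.
have : psi (c%:P - v * q) = 0.
  by apply: kpsi; rewrite rmorphB rmorphM /= evC cE subrr.
rewrite rmorphB rmorphM => /eqP; rewrite subr_eq0 => /eqP e.
have : psi c%:P != 0 by rewrite psiE !map_polyC hornerC fmorph_eq0.
by rewrite e mulf_eq0 negb_or => /andP[].
Qed.

End Algebraic.

Lemma residually_finite_field_adjoin : residually_finite_field ev.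
Proof.
have [trans|] := pselect (forall r, ev r = 0 -> map_poly iota r = 0).
  exact: adjoin_transcendental.
case/existsNP => r /not_implyP[r0 nzr].
have [|p [p0 nzp] minp] := minimal_size
    (P := fun r => ev r = 0 /\ map_poly iota r <> 0); first by exists r.
apply: (adjoin_algebraic p0) => [|s s0 lt_s]; first exact/eqP.
apply/eqP/negPn/negP => /eqP nzs; have := minp s (conj s0 nzs).
by rewrite leqNgt lt_s.
Qed.

End Adjoin.

Lemma residually_finite_field_fg (K : fieldType) (s : seq K) :
  exists (R : idomainType) (iota : {rmorphism R -> K}),
    residually_finite_field iota /\ {in s, forall x, exists r, iota r = x}.
Proof.
elim: s => [|x s [R [iota [resR sR]]]].
  by exists int, (intmul 1); split=> //; apply: residually_finite_field_int.
exists {poly R}, (eval_at iota x).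
split=> [|y].
  exact: (residually_finite_field_adjoin resR (eval_atE iota x)).
rewrite inE => /predU1P[->|/sR[r <-]].
  by exists 'X; rewrite eval_atE map_polyX hornerX.
by exists r%:P; rewrite eval_atE map_polyC hornerC.
Qed.

Local Close Scope ring_scope.

(** * Words and derived subgroups of arbitrary groups *)

Section GroupType.
Variable gT : groupType.
Implicit Types (A B G : set gT) (g h x y z : gT) (u v w : word).

Lemma word_eval_cat g h u v :
  word_eval g h (u ++ v) = word_eval g h u * word_eval g h v.
Proof. by rewrite /word_eval big_cat. Qed.

Lemma word_eval_inv g h u : word_eval g h (word_inv u) = (word_eval g h u)^-1.
Proof.
elim: u => [|l u IHu]; first by rewrite /word_eval !big_nil invg1.
rewrite /word_inv map_cons rev_cons -cats1 word_eval_cat IHu.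
rewrite /word_eval big_seq1 big_cons invMg; congr (_ * _).
by case: l; rewrite /= ?invgK.
Qed.

Lemma word_eval_step g h u (a := word_eval g h u) :
  word_eval g h (quasi_engel_step u) =
  (g * a * g^-1) * (h * a * h^-1) * (g * a * g^-1)^-1 * (h * a * h^-1)^-1.
Proof.
have conjE l l' : word_eval g h ([:: l] ++ u ++ [:: l']) =
    letter_eval g h l * a * letter_eval g h l'.
  by rewrite !word_eval_cat /word_eval !big_seq1 !mulgA.
have commE p q : word_eval g h (word_comm p q) =
    word_eval g h p * word_eval g h q * (word_eval g h p)^-1 *
    (word_eval g h q)^-1.
  by rewrite /word_comm !word_eval_cat !word_eval_inv !mulgA.
by rewrite /quasi_engel_step commE !conjE.
Qed.

Lemma word_eval_in G g h u : is_subgroup G -> G g -> G h -> G (word_eval g h u).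
Proof.
case=> G1 GM GV Gg Gh; rewrite /word_eval; elim: u => [|l u IHu].
  by rewrite big_nil.
by rewrite big_cons; apply: GM => //; case: l => //=; apply: GV.
Qed.

Lemma smallest_subgroup A : is_subgroup (smallest (@is_subgroup gT) A).
Proof.
split=> [B [[B1 _ _] _]|x y Ax Ay B sB|x Ax B sB] //.
  by have [[_ BM _] _] := sB; apply: BM; [apply: Ax | apply: Ay].
by have [[_ _ BV] _] := sB; apply: BV; apply: Ax.
Qed.

Lemma derived_subgroupP A : is_subgroup (derived_subgroup A).
Proof. exact: smallest_subgroup. Qed.

Lemma mem_derived_subgroup A x y :
  A x -> A y -> derived_subgroup A (x * y * x^-1 * y^-1).
Proof. by move=> Ax Ay B [_]; apply; exists x, y. Qed.

Lemma derived_subgroup_min A B : is_subgroup B ->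
  (forall x y, A x -> A y -> B (x * y * x^-1 * y^-1)) ->
  forall z, derived_subgroup A z -> B z.
Proof.
by move=> sB AB z Az; apply: Az; split=> // _ [x [y [Ax Ay ->]]]; apply: AB.
Qed.

Lemma iter_derived_subgroupP A d :
  is_subgroup A -> is_subgroup (iter d (@derived_subgroup gT) A).
Proof. by case: d => // d _; apply: derived_subgroupP. Qed.

Lemma iter_derived_subgroup_sub A B d : (forall x, A x -> B x) ->
  forall x, iter d (@derived_subgroup gT) A x ->
            iter d (@derived_subgroup gT) B x.
Proof.
move=> sAB; elim: d => //= d IHd; apply: derived_subgroup_min.
  exact: derived_subgroupP.
by move=> x y /IHd Bx /IHd By; apply: mem_derived_subgroup.
Qed.

Lemma iter_derived_subgroup_self A d : is_subgroup A ->
  forall x, iter d (@derived_subgroup gT) A x -> A x.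
Proof.
move=> sA; have [_ AM AV] := sA; elim: d => //= d IHd.
apply: derived_subgroup_min => // x y /IHd Ax /IHd Ay.
exact: AM (AM _ _ (AM _ _ Ax Ay) (AV _ Ax)) (AV _ Ay).
Qed.

Lemma iter_derived_subgroup_conj G d : is_subgroup G ->
  forall g x, G g -> iter d (@derived_subgroup gT) G x ->
    iter d (@derived_subgroup gT) G (g * x * g^-1).
Proof.
case=> _ GM GV; elim: d => /= [|d IHd] g x Gg.
  by move=> Gx; exact: GM (GM _ _ Gg Gx) (GV _ Gg).
have [D1 DM DV] := derived_subgroupP (iter d (@derived_subgroup gT) G).
pose P z := derived_subgroup (iter d (@derived_subgroup gT) G) (g * z * g^-1).
apply: (@derived_subgroup_min _ P); rewrite /P.
  split=> [|y z Py Pz|y Py]; first by rewrite mulg1 mulgV.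
    by have := DM _ _ Py Pz; rewrite !mulgA mulgKV.
  by have := DV _ Py; rewrite !invMg invgK mulgA.
move=> y z Dy Dz.
have := mem_derived_subgroup (IHd g y Gg Dy) (IHd g z Gg Dz).
by rewrite !invMg !invgK !mulgA !mulgKV.
Qed.

Lemma solvable_quasi_engel w G :
  is_subgroup G -> solvable_subgroup G -> quasi_engel w G.
Proof.
(* The first word is [w] itself, with value in the 0-th term of the series, so index [d.+1] matches
   [d] derived steps. *)
move=> sG [d Gd]; exists d.+1; split=> // g h Gg Gh /=.
suff: iter d (@derived_subgroup gT) G
    (word_eval g h (iter d quasi_engel_step w)).
  by rewrite Gd.
elim: d {Gd} => [|d IHd] /=; first exact: word_eval_in.
rewrite word_eval_step; apply: mem_derived_subgroup;
  exact: iter_derived_subgroup_conj.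
Qed.

Definition generated (s : seq gT) : set gT :=
  smallest (@is_subgroup gT) [set x | x \in s]%classic.

Lemma generated_min (s : seq gT) B : is_subgroup B -> {in s, forall x, B x} ->
  forall x, generated s x -> B x.
Proof. by move=> sB sB' x; apply; split. Qed.

Lemma generated_sub (s t : seq gT) :
  {subset s <= t} -> forall x, generated s x -> generated t x.
Proof.
move=> st; apply: generated_min; first exact: smallest_subgroup.
by move=> x /st tx B [_]; apply.
Qed.

(** The elements that admit such an [s] form a subgroup containing the commutators: lists of
    witnesses are concatenated. *)
Lemma iter_derived_subgroup_fg G d z : is_subgroup G ->
    iter d (@derived_subgroup gT) G z ->
  exists s : seq gT, {in s, forall x, G x} /\
    iter d (@derived_subgroup gT) (generated s) z.
Proof.
move=> sG; elim: d z => [|d IHd] z /=.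
  move=> Gz; exists [:: z]; split=> [x|B [_]]; first by rewrite inE => /eqP ->.
  by apply; apply: mem_head.
have catG (s t : seq gT) : {in s, forall x, G x} -> {in t, forall x, G x} ->
    {in s ++ t, forall x, G x}.
  by move=> sGs tG x; rewrite mem_cat => /orP[/sGs|/tG].
have catl i (s t : seq gT) x : iter i (@derived_subgroup gT) (generated s) x ->
    iter i (@derived_subgroup gT) (generated (s ++ t)) x.
  apply: iter_derived_subgroup_sub; apply: generated_sub => y sy.
  by rewrite mem_cat sy.
have catr i (s t : seq gT) x : iter i (@derived_subgroup gT) (generated t) x ->
    iter i (@derived_subgroup gT) (generated (s ++ t)) x.
  apply: iter_derived_subgroup_sub; apply: generated_sub => y ty.
  by rewrite mem_cat ty orbT.
move: z; apply: derived_subgroup_min.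
  split=> [|x y [s [sGs sx]] [t [tG ty]]|x [s [sGs sx]]].
  - by exists [::]; split=> //; case: (derived_subgroupP
      (iter d (@derived_subgroup gT) (generated [::]))).
  - exists (s ++ t); split; first exact: catG.
    have [_ DM _] := derived_subgroupP
      (iter d (@derived_subgroup gT) (generated (s ++ t))).
    by apply: DM; [apply: (catl d.+1) | apply: (catr d.+1)].
  - exists s; split=> //.
    by case: (derived_subgroupP (iter d (@derived_subgroup gT) (generated s)))
      => _ _; apply.
move=> x y /IHd[s [sGs sx]] /IHd[t [tG ty]]; exists (s ++ t).
split; first exact: catG.
by apply: mem_derived_subgroup; [apply: catl | apply: catr].
Qed.

Section Morphism.
Variables (hT : groupType) (G : set gT) (f : gT -> hT).
Hypothesis sG : is_subgroup G.
Hypothesis fM : forall x y, G x -> G y -> f (x * y) = f x * f y.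

(** [f] is multiplicative on [G] only, since a matrix can be specialised only if its entries lie in
    the chosen subring. *)
Lemma local_morph1 : f 1 = 1.
Proof.
by case: sG => G1 _ _; apply: (mulgI (f 1)); rewrite -fM // !mulg1.
Qed.

Lemma local_morphV x : G x -> f x^-1 = (f x)^-1.
Proof.
case: sG => _ _ GV Gx; apply: (mulgI (f x)).
by rewrite -fM ?mulgV ?local_morph1 //; apply: GV.
Qed.

Lemma local_morph_word g h u : G g -> G h ->
  f (word_eval g h u) = word_eval (f g) (f h) u.
Proof.
move=> Gg Gh; elim: u => [|l u IHu].
  by rewrite /word_eval !big_nil local_morph1.
have [_ _ GV] := sG.
have Gl : G (letter_eval g h l) by case: l => //=; apply: GV.
rewrite /word_eval !big_cons fM //; last exact: word_eval_in.
congr (_ * _) => //; case: l {Gl} => //=; exact: local_morphV.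
Qed.

End Morphism.
End GroupType.

Lemma local_morph_derived (gT : groupType) (hT : finGroupType) (G : set gT)
    (H : {group hT}) (f : gT -> hT) (d : nat) (z : gT) :
    is_subgroup G -> (forall x y, G x -> G y -> f (x * y) = f x * f y) ->
    (forall x, G x -> f x \in H) ->
  iter d (@derived_subgroup gT) G z -> f z \in H^`(d).
Proof.
move=> sG fM fH dz; have [G1 GM GV] := sG.
suff [] : G z /\ f z \in H^`(d) by [].
elim: d z dz => [|d IHd] /=; first by move=> z Gz; split=> //; apply: fH.
apply: derived_subgroup_min.
  split=> [|x y [Gx fx] [Gy fy]|x [Gx fx]].
  - by rewrite (local_morph1 sG fM) group1.
  - by split; [exact: GM | rewrite fM // groupM].
  - by split; [exact: GV | rewrite (local_morphV sG fM) // groupV].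
move=> x y /IHd[Gx fx] /IHd[Gy fy]; have GxV := GV x Gx; have GyV := GV y Gy.
have Gxy := GM x y Gx Gy; have Gxyx := GM _ _ Gxy GxV; split; first exact: GM.
rewrite !fM // !(local_morphV sG fM) //.
(* The inverses translate between the two commutator conventions. *)
have -> : f x * f y * (f x)^-1 * (f y)^-1 = [~ (f x)^-1, (f y)^-1].
  by rewrite /commg /conjg !invgK !mulgA.
by rewrite dergSn mem_commg ?groupV.
Qed.

(** * Linear groups *)

Section LinearGroup.
Variables (K : fieldType) (n : nat) (R : idomainType).
Variable iota : {rmorphism R -> K}.

Definition entries_in (x : GL n.+1 K) : Prop :=
  exists M : 'M[R]_n.+1, map_mx iota M = GL_val x.

(** Inverses are tracked as well, since inverting a matrix can lead out of the subring. *)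
Lemma generated_entries_in (s : seq (GL n.+1 K)) :
    {in s, forall x, entries_in x /\ entries_in x^-1} ->
  forall x, generated s x -> entries_in x /\ entries_in x^-1.
Proof.
move=> sR x; apply: (generated_min _ sR) => {x}; split=> [|x y Rx Ry|x [? ?]].
- by rewrite invg1; split; exists 1%:M%R; rewrite map_mx1.
- rewrite invMg; case: Rx Ry => -[M1 e1] [N1 f1] [[M2 e2] [N2 f2]].
  split; [exists (M1 *m M2)%R | exists (N2 *m N1)%R];
    by rewrite map_mxM ?e1 ?e2 ?f1 ?f2.
- by rewrite invgK.
Qed.

(** Two lifts of a matrix to [R] differ by entries in the kernel of [iota], which [phi] kills, so
    the image is well defined; the lift of the inverse makes it invertible. *)
Lemma specialise_subgroup (F : finFieldType) (phi : {rmorphism R -> F})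
    (G : set (GL n.+1 K)) :
    (forall r, iota r = 0 -> phi r = 0)%R -> is_subgroup G ->
    (forall x, G x -> entries_in x /\ entries_in x^-1) ->
  exists f : GL n.+1 K -> {'GL_n.+1[F]},
    (forall x y, G x -> G y -> f (x * y) = f x * f y) /\
    (forall x M, G x -> map_mx iota M = GL_val x ->
       GLval (f x) = map_mx phi M).
Proof.
move=> ker [G1 GM GV] RG.
have kerM (M N : 'M[R]_n.+1) :
    map_mx iota M = map_mx iota N -> map_mx phi M = map_mx phi N.
  move=> e; apply/matrixP => i j; apply/eqP.
  rewrite !mxE -subr_eq0 -rmorphB; apply/eqP/ker.
  by have /matrixP/(_ i j) := e; rewrite !mxE rmorphB => ->; rewrite subrr.
have exf x : exists u : {'GL_n.+1[F]}, G x -> forall M,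
    map_mx iota M = GL_val x -> GLval u = map_mx phi M.
  have [Gx|nGx] := pselect (G x); last by exists 1.
  have [[M e] [N f]] := RG x Gx.
  have MN : (map_mx phi M *m map_mx phi N = 1%:M)%R.
    rewrite -map_mxM -(map_mx1 phi); apply: kerM.
    by rewrite map_mxM e f map_mx1 mulmxV ?GL_valP.
  have uM : (map_mx phi M)%R \is a GRing.unit by have [] := mulmx1_unit MN.
  by exists (FinRing.unit _ uM) => _ M' e'; apply: kerM; rewrite e e'.
have [f fP] := choice exf; exists f; split=> [x y Gx Gy|x M Gx]; last exact: fP.
have [[M e] _] := RG x Gx; have [[N e'] _] := RG y Gy.
apply/val_inj; rewrite /= [LHS](fP _ (GM _ _ Gx Gy) (M *m N)%R); last first.
  by rewrite map_mxM e e'.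
by rewrite map_mxM -(fP x Gx M e) -(fP y Gy N e').
Qed.

End LinearGroup.

Lemma fg_linear_specialisation (K : fieldType) (n : nat) (s : seq (GL n.+1 K))
    (z : GL n.+1 K) : generated s z -> z <> 1 ->
  exists (F : finFieldType) (f : GL n.+1 K -> {'GL_n.+1[F]}),
    (forall x y, generated s x -> generated s y -> f (x * y) = f x * f y) /\
    f z <> 1.
Proof.
move=> sz nz1.
pose t := s ++ [seq x^-1 | x <- s].
pose es := [seq GL_val x i.1 i.2 | x <- t,
             i <- enum (setT : {set 'I_n.+1 * 'I_n.+1})].
have [R [iota [resR Res]]] := residually_finite_field_fg es.
have Rt x : x \in t -> entries_in iota x.
  move=> tx; have ex i j : exists r, iota r = GL_val x i j.
    apply: Res; apply/allpairsP; exists (x, (i, j)).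
    by rewrite tx mem_enum inE.
  have [M eM] := choice (fun ij => ex ij.1 ij.2).
  by exists (\matrix_(i, j) M (i, j))%R; apply/matrixP => i j; rewrite !mxE eM.
have Rs : {in s, forall x, entries_in iota x /\ entries_in iota x^-1}.
  by move=> x sx; split; apply: Rt; rewrite mem_cat ?sx // map_f ?orbT.
have RG := generated_entries_in Rs; have [[M eM] _] := RG z sz.
have [i [j nzij]] : exists i j, iota ((M - 1%:M)%R i j) != 0%R.
  apply: contrapT => H; apply: nz1; apply/val_inj; rewrite /= -eM.
  apply/matrixP => i j; apply: contrapT => Hij; apply: H; exists i, j.
  by move/eqP: Hij; rewrite !mxE rmorphB rmorph_nat -subr_eq0.
have [F [phi [ker nzphi]]] := resR _ nzij.
have [f [fM fE]] := specialise_subgroup ker (smallest_subgroup _) RG.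
exists F, f; split=> // fz; case/negP: nzphi.
have := fE z M sz eM; rewrite fz GL_1E => /matrixP/(_ i j).
by rewrite !mxE rmorphB rmorph_nat => <-; rewrite subrr.
Qed.

Theorem corollary1p15 (w : word)
    (hw : forall (gT : finGroupType) (H : {group gT}),
        solvable H <-> quasi_engel w [set x : gT | x \in H]%classic)
    (K : fieldType) (n : nat) (hn : (1 <= n)%N)
    (G : set (GL n K)) (hG : is_subgroup G) :
  solvable_subgroup G <-> quasi_engel w G.
Proof.
split; first exact: solvable_quasi_engel.
case: n hn G hG => // n _ G hG [m [m1 idG]].
(* The depth depends on the degree alone, not on [m] or on the finite field chosen later. *)
exists (zassenhaus_bound n.+1); apply/seteqP; split=> z; last first.
  move=> /= ->; by case: (iter_derived_subgroupP (zassenhaus_bound n.+1) hG).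
move=> /(iter_derived_subgroup_fg hG)[s [sG dz]] /=; apply: contrapT => nz1.
have sgs : is_subgroup (generated s) by apply: smallest_subgroup.
have gsG := generated_min hG sG.
have sz : generated s z by apply: iter_derived_subgroup_self dz.
have [F [f [fM fz]]] := fg_linear_specialisation sz nz1; apply: fz.
(* The image of the subgroup generated by [s]. *)
pose H0 := [set u | `[< exists2 x, generated s x & f x = u >]]%SET.
have H0P u : reflect (exists2 x, generated s x & f x = u) (u \in H0).
  by rewrite inE; apply: asboolP.
have gH0 : group_set H0.
  apply/group_setP; split=> [|_ _ /H0P[x sx <-] /H0P[y sy <-]]; apply/H0P.
    by exists 1; [case: sgs | apply: (local_morph1 sgs fM)].
  by exists (x * y); [case: sgs => _ + _; apply | rewrite fM].
have solH : solvable (Group gH0).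
  apply/hw; exists m; split=> // _ _ /H0P[g sg <-] /H0P[h sh <-].
  rewrite -(local_morph_word sgs fM) // idG; try exact: gsG.
  exact: (local_morph1 sgs fM).
have : f z \in (Group gH0)^`(zassenhaus_bound n.+1).
  by apply: local_morph_derived dz => // x sx; apply/H0P; exists x.
by rewrite zassenhaus_GL // => /set1P.
Qed.
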